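(* Let $G$ be a distance-regular graph with diameter $d\ge 2$ and distinct adjacency eigenvalues $\theta_0>\theta_1>\cdots>\theta_d$. Then \[ c_2(G)^2\ \geq\ \max_{r\in\{d-1,d\}}\left\{ r^2\min_{j\in\{1,\dots,d\}}\left\{\frac{1-w_1(\theta_j)}{1-w_r(\theta_j)}\right\}\right\}. \]
   Context: A connected graph $G$ of diameter $d$ is distance-regular if it is $k$-regular and there are numbers $b_i,c_i$ such that for any two vertices $x,y$ at distance $i$, exactly $c_i$ neighbours of $y$ are at distance $i-1$ from $x$ and exactly $b_i$ are at distance $i+1$ from $x$; set $a_i=k-b_i-c_i$. For an eigenvalue $\theta$, the cosine sequence is defined by $w_0(\theta)=1$, $w_1(\theta)=\theta/k$, $c_iw_{i-1}(\theta)+a_iw_i(\theta)+b_iw_{i+1}(\theta)=\theta w_i(\theta)$ ($1\le i\le d-1$). A quotient with zero denominator (and positive numerator) is interpreted as $+\infty$. For an injective map $\rho$ of the vertex set (with shortest-path metric $\delta$) into $\mathbb{R}^n$, expansion$(\rho)=\max_{x\ne y}\|\rho(x)-\rho(y)\|/\delta(x,y)$, contraction$(\rho)=\max_{x\ne y}\delta(x,y)/\|\rho(x)-\rho(y)\|$, distortion = expansion$\cdot$contraction; $c_2(G)$ is the least distortion of such an embedding into Euclidean space. *)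

(* Defs.v *)
From HB Require Import structures.
From mathcomp Require Import all_boot all_order all_algebra.
From mathcomp Require Import all_classical all_reals.

Set Implicit Arguments.
Unset Strict Implicit.
Unset Printing Implicit Defensive.

Import Order.TTheory GRing.Theory Num.Theory.

Local Open Scope ring_scope.

(* Simple graphs on a finite vertex type T are given by an adjacency relation
   e : rel T. *)

(* Least length (number of edges) of a walk from x to y. Such a least length is
   at most #|T|.-1, so the search range is large enough; the value is #|T| when
   x and y are not connected. *)
Definition gdist (T : finType) (e : rel T) (x y : T) : nat :=
  find (fun n => [exists p : n.-tuple T, path e x p && (last x p == y)])
       (iota 0 #|T|).

Definition diameter (T : finType) (e : rel T) : nat :=
  (\max_(x : T) \max_(y : T) gdist e x y)%N.

(* Only the values b i and c i with i <= diameter e are constrained. With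
   i = 0 this forces c 0 = 0 and b 0 = k. *)
Definition distance_regular (T : finType) (e : rel T) (k : nat)
    (b c : nat -> nat) : Prop :=
  [/\ symmetric e /\ irreflexive e,
      forall x y, connect e x y,
      forall x, #|[set y | e x y]| = k,
      forall x y,
        #|[set z | e y z & (gdist e x z).+1 == gdist e x y]| = c (gdist e x y)
    & forall x y,
        #|[set z | e y z & gdist e x z == (gdist e x y).+1]| = b (gdist e x y)].

Definition adjacency (R : realType) (T : finType) (e : rel T) : 'M[R]_#|T| :=
  \matrix_(i, j) (e (enum_val i) (enum_val j))%:R.

(* The values w i with i > d are unconstrained. *)
Definition cosine_sequence (R : realType) (d k : nat) (b c : nat -> nat)
    (theta : R) (w : nat -> R) : Prop :=
  [/\ w 0%N = 1,
      w 1%N = theta / k%:R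
    & forall i, (1 <= i <= d.-1)%N ->
        let a := k%:R - (b i)%:R - (c i)%:R in
        (c i)%:R * w i.-1 + a * w i + (b i)%:R * w i.+1 = theta * w i].

(* The norm that MathComp-Analysis puts on 'rV[R]_n is the sup norm. *)
Definition enorm (R : realType) (n : nat) (v : 'rV[R]_n) : R :=
  Num.sqrt (\sum_(i < n) v 0 i ^+ 2).

Section Distortion.
Variables (R : realType) (T : finType) (e : rel T).

(* The ratios below are nonnegative, so 0 is neutral for the maximum. *)
Definition expansion (n : nat) (rho : T -> 'rV[R]_n) : R :=
  \big[Num.max/0]_(p : T * T | p.1 != p.2)
    (enorm (rho p.1 - rho p.2) / (gdist e p.1 p.2)%:R).

Definition contraction (n : nat) (rho : T -> 'rV[R]_n) : R :=
  \big[Num.max/0]_(p : T * T | p.1 != p.2)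
    ((gdist e p.1 p.2)%:R / enorm (rho p.1 - rho p.2)).

Definition distortion (n : nat) (rho : T -> 'rV[R]_n) : R :=
  expansion rho * contraction rho.

(* The set of distortions is nonempty (embed T as the standard basis of a
   #|T|-dimensional space) and bounded below by 0, so inf is the genuine
   infimum. *)
Definition c2 : R :=
  inf [set D : R | exists n, exists rho : T -> 'rV[R]_n,
                     injective rho /\ D = distortion rho]%classic.

End Distortion.

(* Main.v *)
(* Write B_i = A_i / k_i for the normalised distance matrices.  They satisfy
   A B_i = c_i B_{i-1} + a_i B_i + b_i B_{i+1}, the recurrence of the cosine
   sequences, with B_0 = 1 and B_{d+1} = 0.  Hence a polynomial of degree d+1
   annihilates A; having the d+1 distinct roots theta_j it makes A diagonalisable,
   and B_i acts on the theta_j-eigenspace as w_i(theta_j).  Decomposing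
   v = sum_j u_j into eigenvectors,
     sum_{x,y} B_i(x,y) (v_x - v_y)^2 = 2 sum_j (1 - w_i(theta_j)) |u_j|^2,
   so if t (1 - w_r(theta_j)) <= 1 - w_1(theta_j) for all j, then t times the energy
   at distance r is at most the energy along edges.  Summed over the coordinates of
   an embedding, the former is at least t r^2 n / contraction^2 and the latter at
   most expansion^2 n, where n is the number of vertices. *)
Require Import Defs.
From mathcomp Require Import all_boot all_order all_algebra.
From mathcomp Require Import all_classical all_reals.
From mathcomp Require Import ring zify.

Set Implicit Arguments.
Unset Strict Implicit.
Unset Printing Implicit Defensive.

Import Order.TTheory GRing.Theory Num.Theory.

Local Open Scope ring_scope.

(** * Graph distance as least walk length *)

Lemma find_iotaP (P : pred nat) (m n : nat) :
  (m < n)%N -> P m -> P (find P (iota 0 n)) /\ (find P (iota 0 n) <= m)%N.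
Proof.
move=> mn Pm.
have hasP : has P (iota 0 n) by apply/hasP; exists m; rewrite ?mem_iota.
have := nth_find 0%N hasP; move: (hasP).
rewrite has_find size_iota => lt; rewrite nth_iota // add0n => Pf; split=> //.
rewrite leqNgt; apply/negP => ltm; have := before_find 0%N ltm.
by rewrite nth_iota // add0n Pm.
Qed.

Section GraphDistance.
Variables (T : finType) (e : rel T).
Hypothesis econn : forall x y, connect e x y.

(** Removing repeated vertices from a walk leaves fewer than [#|T|] edges, so the bounded search in
    [gdist] succeeds. *)
Lemma gdist_walk x y :
  exists p, [/\ size p = gdist e x y, path e x p & last x p = y].
Proof.
have /connectP[q qe ->] := econn x y.
case/shortenP: qe => p pe pu _.
have ltp : (size p < #|T|)%N.
  by have /card_uniqP /= <- := pu; apply: max_card.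
have Pp : [exists p' : (size p).-tuple T,
             path e x p' && (last x p' == last x p)].
  by apply/existsP; exists (in_tuple p); rewrite pe eqxx.
pose P n := [exists p' : n.-tuple T, path e x p' && (last x p' == last x p)].
have [/existsP[t /andP[te /eqP tl]] _] := @find_iotaP P _ _ ltp Pp.
by exists t; rewrite size_tuple.
Qed.

Lemma gdist_le x p : path e x p -> (gdist e x (last x p) <= size p)%N.
Proof.
move=> pe; have [ltp|] := ltnP (size p) #|T|; last first.
  (* The search never returns more than [#|T|], which settles walks of at least that length. *)
  by apply: leq_trans; rewrite /gdist -[X in (_ <= X)%N](size_iota 0) find_size.
pose P n := [exists p' : n.-tuple T, path e x p' && (last x p' == last x p)].
apply: (proj2 (@find_iotaP P _ _ ltp _)).
by apply/existsP; exists (in_tuple p); rewrite pe eqxx.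
Qed.

Lemma gdistxx x : gdist e x x = 0%N.
Proof. by have := @gdist_le x [::] isT; rewrite leqn0 => /eqP. Qed.

Lemma gdist_eq0 x y : (gdist e x y == 0%N) = (x == y).
Proof.
apply/idP/idP => [/eqP d0|/eqP->]; last by rewrite gdistxx.
have [p [sp _ <-]] := gdist_walk x y; rewrite d0 in sp.
by rewrite (size0nil sp).
Qed.

Lemma gdist_edge x y z : e y z -> (gdist e x z <= (gdist e x y).+1)%N.
Proof.
have [p [<- pe pl]] := gdist_walk x y => eyz.
have := @gdist_le x (rcons p z); rewrite rcons_path pe pl eyz last_rcons.
by rewrite size_rcons; apply.
Qed.

Hypothesis esym : symmetric e.

Lemma gdistC x y : gdist e x y = gdist e y x.
Proof.
suff le u v : (gdist e v u <= gdist e u v)%N.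
  by apply/eqP; rewrite eqn_leq !le.
have [p [<- pe pl]] := gdist_walk u v.
have pr : path e v (rev (belast u p)).
  by rewrite -pl rev_path (eq_path (e' := e)) // => a b; rewrite esym.
have := gdist_le pr; rewrite size_rev size_belast.
suff -> : last v (rev (belast u p)) = u by [].
by case: (p) pl => [/= ->|a q] //=; rewrite rev_cons last_rcons.
Qed.

Lemma gdist_pred x y n :
  gdist e x y = n.+1 -> exists2 z, e y z & gdist e x z = n.
Proof.
have [p [sp pe pl]] := gdist_walk x y => dn; rewrite dn in sp.
case/lastP: p => // p a in sp pe pl *.
rewrite last_rcons in pl; rewrite size_rcons in sp; rewrite rcons_path in pe.
case/andP: pe => pe ela; subst a; exists (last x p); first by rewrite esym.
by move: (gdist_le pe) (gdist_edge x ela); rewrite dn; lia.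
Qed.

Hypothesis eirr : irreflexive e.

Lemma gdist_eq1 x y : (gdist e x y == 1%N) = e x y.
Proof.
apply/idP/idP => [/eqP /gdist_pred[z eyz /eqP]|exy].
  by rewrite gdist_eq0 esym => /eqP->.
have := gdist_edge x exy; rewrite gdistxx leq_eqVlt ltnS leqn0 gdist_eq0.
by case/orP=> // /eqP xy; rewrite xy eirr in exy.
Qed.

Lemma gdist_le_diameter x y : (gdist e x y <= diameter e)%N.
Proof.
apply: leq_trans (leq_bigmax x) => /=.
exact: (leq_bigmax (F := fun y => gdist e x y)).
Qed.

Lemma diameter_attained : (0 < #|T|)%N -> exists x y, gdist e x y = diameter e.
Proof.
move=> T0; rewrite /diameter.
have [x ->] := @bigop.eq_bigmax T (fun x => \max_y gdist e x y)%N T0.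
by have [y ->] := @bigop.eq_bigmax T (fun y => gdist e x y)%N T0; exists x, y.
Qed.

(** Distances drop by one at each step back along a shortest walk from a diametral pair. The numbers
    [b n] and [c n] get their meaning only through such pairs. *)
Lemma gdist_attained n :
  (0 < #|T|)%N -> (n <= diameter e)%N -> exists x y, gdist e x y = n.
Proof.
move=> T0 nd; have [x [y dxy]] := diameter_attained T0.
exists x; rewrite -dxy in nd; move: nd; move dm : (gdist e x y) => m.
elim: m y dm {dxy} => [|m IH] y dy.
  by rewrite leqn0 => /eqP->; exists y.
rewrite leq_eqVlt => /orP[/eqP->|]; first by exists y.
have [z _ dz] := gdist_pred dy.
exact: IH dz.
Qed.

End GraphDistance.

(** * Three-term matrix recurrences *)

(* At i = 0 the index i.-1 is again 0, so the ga 0 term merely adds to the al 0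
   term. *)
Section ThreeTerm.
Variables (F : fieldType) (n d : nat) (M : 'M[F]_n) (B : nat -> 'M[F]_n).
Variables al be ga : nat -> F.
Hypothesis B0 : B 0%N = 1%:M.
Hypothesis Brec : forall i, (i <= d)%N ->
  M *m B i = ga i *: B i.-1 + al i *: B i + be i *: B i.+1.

(** Left multiplication by [v] turns the matrix recurrence into that of [w]; as [be i] is
    invertible, each term is determined by the two before it. *)
Lemma three_term_eigenvector (v : 'rV[F]_n) (t : F) (w : nat -> F) :
  (forall i, (i < d)%N -> be i != 0) ->
  (forall i, (i < d)%N -> ga i * w i.-1 + al i * w i + be i * w i.+1 = t * w i) ->
  w 0%N = 1 -> v *m M = t *: v ->
  forall i, (i <= d)%N -> v *m B i = w i *: v.
Proof.
move=> be0 wrec w0 vM i id.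
suff [] : (v *m B i.-1 = w i.-1 *: v) /\ (v *m B i = w i *: v) by [].
elim: i id => [|i IH] id; first by rewrite B0 mulmx1 w0 scale1r.
have [IH1 IH2] := IH (ltnW id); split=> //=.
have := congr1 (mulmx v) (Brec (ltnW id)).
rewrite mulmxA vM -scalemxAl !mulmxDr -!scalemxAr IH1 IH2.
rewrite !scalerA -(wrec i id) !scalerDl => /addrI /(congr1 ( *:%R (be i)^-1)).
by rewrite !scalerA mulrA mulVf ?be0 // mul1r scale1r => <-.
Qed.

End ThreeTerm.

(** Solving for [B i.+1] multiplies by ['X] and divides by [be i], so the degree rises by exactly
    one. The exact size is what allows counting roots of the annihilating polynomial. *)
Lemma three_term_horner (F : fieldType) (n d : nat) (M : 'M[F]_n.+1)
    (B : nat -> 'M[F]_n.+1) (al be ga : nat -> F) :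
    B 0%N = 1%:M ->
    (forall i, (i <= d)%N ->
      be i != 0 /\ M *m B i = ga i *: B i.-1 + al i *: B i + be i *: B i.+1) ->
  forall i, (i <= d.+1)%N ->
    exists p : {poly F}, size p = i.+1 /\ horner_mx M p = B i.
Proof.
move=> B0 Brec i id.
suff [] : (exists p : {poly F}, (size p <= i.+1)%N /\ horner_mx M p = B i.-1) /\
  (exists p : {poly F}, size p = i.+1 /\ horner_mx M p = B i) by [].
elim: i id => [|i IH] id.
  by rewrite B0; split; exists 1; rewrite size_poly1 rmorph1.
have [[q [sq qB]] [p [sp pB]]] := IH (ltnW id); split.
  by exists p; rewrite sp leqnSn.
have [be0 Mi] := Brec i id.
exists ((be i)^-1 *: ('X * p - (ga i *: q + al i *: p))).
have small : (size (ga i *: q + al i *: p)%R < i.+2)%N.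
  rewrite ltnS (leq_trans (size_polyD _ _)) // geq_max.
  by rewrite !(leq_trans (size_scale_leq _ _)) ?sp.
have p0 : p != 0 by rewrite -size_poly_eq0 sp.
split.
  rewrite size_scale ?invr_eq0 // size_polyDl ?size_mulX // mulrC size_mulX ?sp //.
  by rewrite size_polyN.
rewrite horner_mxZ rmorphB rmorphM rmorphD /= !horner_mxZ horner_mx_X pB qB.
rewrite -[M * _]/(M *m _) Mi addrC addKr scalerA mulVf // scale1r //.
Qed.

(** The polynomial of degree [d.+1] that yields [B d.+1 = 0] has all the [theta j] as roots, so it
    is a scalar multiple of the product of these distinct linear factors. The minimal polynomial
    divides that product, hence the eigenspaces span the space. *)
Lemma three_term_eigen_decomposition (F : fieldType) (n d : nat) (M : 'M[F]_n)
    (B : nat -> 'M[F]_n) (al be ga : nat -> F) (theta : 'I_d.+1 -> F) :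
    B 0%N = 1%:M -> B d.+1 = 0 ->
    (forall i, (i <= d)%N ->
      be i != 0 /\ M *m B i = ga i *: B i.-1 + al i *: B i + be i *: B i.+1) ->
    injective theta -> (forall j, eigenvalue M (theta j)) ->
  forall v : 'rV[F]_n, exists u : 'I_d.+1 -> 'rV[F]_n,
    v = \sum_j u j /\ forall j, u j *m M = theta j *: u j.
Proof.
(* [horner_mx] needs a positive matrix size, so dimension 0 is split off. *)
case: n M B => [|n] M B.
  by move=> *; exists (fun=> 0); split=> [|j]; apply/rowP => -[].
move=> B0 BS Brec inj_th eig v.
have [p [sp pB]] := three_term_horner B0 Brec (leqnn d.+1).
rewrite BS in pB.
have p0 : p != 0 by rewrite -size_poly_eq0 sp.
pose q := \prod_j ('X - (theta j)%:P).
have pq : p %= q.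
  have -> : q = \prod_(z <- map theta (enum 'I_d.+1)) ('X - z%:P).
    by rewrite big_map big_enum.
  rewrite {1}(@all_roots_prod_XsubC _ p (map theta (enum 'I_d.+1))).
  - by rewrite eqp_scale // lead_coef_eq0.
  - by rewrite sp size_map size_enum_ord.
  - apply/allP => _ /mapP[j _ ->].
    rewrite -dvdp_XsubCl; apply: dvdp_trans (mxminpoly_min pB).
    by rewrite dvdp_XsubCl -eigenvalue_root_min.
  - by rewrite uniq_rootsE map_inj_uniq // enum_uniq.
have qM : mxminpoly M %| q by rewrite -(eqp_dvdr _ pq) mxminpoly_min.
have /eqmxP/andP[_] : (\sum_j eigenspace M (theta j) :=: 1%:M)%MS.
  rewrite (eq_bigr _ (fun _ _ => eigenspace_poly _ _)).
  apply: (eqmx_trans (eqmx_sym (kermxpoly_prod _ _)) (kermxpoly_min _)) => //.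
  by move=> i j _ _; rewrite coprimep_XsubC root_XsubC inj_eq.
move=> /(submx_trans (submx1 v))/sub_sumsmxP[u ->].
exists (fun j => u j *m eigenspace M (theta j)); split=> // j.
by apply/eigenspaceP; rewrite submxMl.
Qed.

(** * Distance matrices of a distance-regular graph *)

Section DistanceMatrices.
Variables (R : realType) (T : finType) (e : rel T) (k : nat) (b c : nat -> nat).
Hypothesis hG : distance_regular e k b c.
Let d := diameter e.
Hypothesis d0 : (0 < d)%N.

Let esym : symmetric e. Proof. by case: hG => -[]. Qed.
Let eirr : irreflexive e. Proof. by case: hG => -[]. Qed.
Let econn : forall x y, connect e x y. Proof. by case: hG. Qed.

Lemma card_gt0_of_diameter : (0 < #|T|)%N.
Proof.
rewrite lt0n; apply: contraTneq d0 => /card0_eq T0.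
by rewrite /d /diameter big1 // => x; have := T0 x; rewrite inE.
Qed.
Let T0 := card_gt0_of_diameter.

Lemma card_nbr_closer x y :
  #|[set z | e y z & (gdist e x z).+1 == gdist e x y]| = c (gdist e x y).
Proof. by case: hG. Qed.

Lemma card_nbr_farther x y :
  #|[set z | e y z & gdist e x z == (gdist e x y).+1]| = b (gdist e x y).
Proof. by case: hG. Qed.

Lemma card_nbr x : #|[set y | e x y]| = k.
Proof. by case: hG. Qed.

Lemma drg_c0 : c 0%N = 0%N.
Proof.
have [x _] := card_gt0P T0.
rewrite -(gdistxx e x) -card_nbr_closer gdistxx //.
by apply: eq_card0 => z; rewrite !inE andbF.
Qed.

Lemma drg_b0 : b 0%N = k.
Proof.
have [x _] := card_gt0P T0.
rewrite -(gdistxx e x) -card_nbr_farther gdistxx // -(card_nbr x).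
by apply: eq_card => z; rewrite !inE gdist_eq1 // andbb.
Qed.

(** In a pair at distance [i.+1], the vertex just before the end of a shortest walk has that end as
    a farther neighbour. *)
Lemma drg_b_gt0 i : (i < d)%N -> (0 < b i)%N.
Proof.
move=> /(gdist_attained econn esym T0)[x [y dxy]].
have [z eyz dz] := gdist_pred econn esym dxy.
rewrite -dz -card_nbr_farther; apply/card_gt0P; exists y.
by rewrite !inE esym eyz dxy dz eqxx.
Qed.

Lemma drg_c_gt0 i : (i < d)%N -> (0 < c i.+1)%N.
Proof.
move=> /(gdist_attained econn esym T0)[x [y dxy]].
have [z eyz dz] := gdist_pred econn esym dxy.
rewrite -dxy -card_nbr_closer; apply/card_gt0P; exists z.
by rewrite !inE eyz dxy dz eqxx.
Qed.

Lemma drg_k_gt0 : (0 < k)%N.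
Proof. by rewrite -drg_b0 drg_b_gt0. Qed.

Definition intersection_a i : R := k%:R - (b i)%:R - (c i)%:R.

(** Along an edge the distance from [x] changes by at most one, which leaves three classes of
    neighbours. This identifies [intersection_a] as a count. *)
Lemma card_nbr_split x y (m := gdist e x y) :
  (#|[set z | e y z & gdist e x z == m]| + c m + b m)%N = k.
Proof.
rewrite -card_nbr_closer -card_nbr_farther -(card_nbr y) -!sum1_card.
rewrite !(big_mkcond (fun z => z \in _)) -!big_split /=.
apply: eq_bigr => z _; rewrite !inE -/m; case: (boolP (e y z)) => // eyz.
have := gdist_edge econn x eyz; rewrite -/m.
rewrite esym in eyz; have := gdist_edge econn x eyz; rewrite -/m.
by case: (eqVneq (gdist e x z) m); case: (eqVneq (gdist e x z).+1 m);
  case: (eqVneq (gdist e x z) m.+1) => //=; lia.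
Qed.

Lemma card_nbr_at x y i (m := gdist e x y) :
  #|[set z | e y z & gdist e x z == i]|%:R =
  if m == i.+1 then (c m)%:R else if m == i then intersection_a i
  else if i == m.+1 then (b m)%:R else 0 :> R.
Proof.
case: eqP => [mi|ni1].
  by rewrite -card_nbr_closer -/m mi.
case: eqP => [mi|ni].
  rewrite /intersection_a -mi -(card_nbr_split x y) -/m !natrD; ring.
case: eqP => [->|ni2]; first by rewrite -card_nbr_farther.
rewrite eq_card0 // => z; rewrite !inE; apply/negbTE/negP => /andP[eyz /eqP dz].
have := gdist_edge econn x eyz; rewrite -/m dz.
rewrite esym in eyz; have := gdist_edge econn x eyz; rewrite -/m dz; lia.
Qed.

(* The sphere size k_i, from k_i b_i = k_{i+1} c_{i+1}. *)
Fixpoint dist_degree i : R :=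
  if i is j.+1 then dist_degree j * (b j)%:R / (c j.+1)%:R else 1.

Lemma dist_degree_gt0 i : (i <= d)%N -> 0 < dist_degree i.
Proof.
elim: i => [|i IH] id //=; rewrite divr_gt0 ?mulr_gt0 ?ltr0n //.
- exact: IH (ltnW id).
- exact: drg_b_gt0.
- exact: drg_c_gt0.
Qed.

Definition dist_mx i : 'M[R]_#|T| := \matrix_(x, y)
  ((gdist e (enum_val x) (enum_val y) == i)%:R / dist_degree i).

Lemma dist_mx0 : dist_mx 0 = 1%:M.
Proof.
apply/matrixP => x y; rewrite !mxE divr1 gdist_eq0 //.
by rewrite (inj_eq enum_val_inj).
Qed.

Lemma dist_mx_diameterS : dist_mx d.+1 = 0.
Proof.
apply/matrixP => x y; rewrite !mxE; case: eqP => [dxy|_]; last by rewrite mul0r.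
by have := gdist_le_diameter e (enum_val x) (enum_val y); rewrite dxy ltnn.
Qed.

Lemma dist_mx_sym i x y : dist_mx i x y = dist_mx i y x.
Proof. by rewrite !mxE gdistC. Qed.

Lemma dist_mx_ge0 i x y : (i <= d)%N -> 0 <= dist_mx i x y.
Proof. by move=> id; rewrite mxE divr_ge0 ?ler0n // ltW ?dist_degree_gt0. Qed.

Lemma sum_enum_val (F : T -> R) : \sum_(z < #|T|) F (enum_val z) = \sum_z F z.
Proof. by rewrite -(big_enum_val F). Qed.

(* b_d = 0, but it multiplies dist_mx d.+1 = 0, so 1 may replace it; this keeps
   every leading coefficient of the recurrence invertible. *)
Definition beta i : R := if (i < d)%N then (b i)%:R else 1.

(** Up to normalisation, the product counts the neighbours of one vertex at distance [i] from
    another, which is an intersection number. Dividing by the sphere sizes exchanges the roles of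
    [b] and [c], by k_i b_i = k_{i+1} c_{i+1}. *)
Lemma dist_mx_recurrence i : (i <= d)%N ->
  beta i != 0 /\
  adjacency R e *m dist_mx i =
  (c i)%:R *: dist_mx i.-1 + intersection_a i *: dist_mx i + beta i *: dist_mx i.+1.
Proof.
move=> id; split.
  rewrite /beta; case: ifP => [/drg_b_gt0|_]; last exact: oner_neq0.
  by rewrite pnatr_eq0 -lt0n.
apply/matrixP => x y; rewrite !mxE.
set m := gdist e (enum_val x) (enum_val y).
have md : (m <= d)%N by exact: gdist_le_diameter.
transitivity (#|[set z | e (enum_val x) z & gdist e (enum_val y) z == i]|%:R
   / dist_degree i).
  rewrite -sum1_card natr_sum [in RHS]big_mkcond /= mulr_suml -sum_enum_val.
  apply: eq_bigr => z _; rewrite !mxE !inE (gdistC econn esym (enum_val y)).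
  by case: (e _ _); case: (_ == _); rewrite ?mul0r ?mul1r.
rewrite card_nbr_at gdistC // -/m.
have K0 j : (j <= d)%N -> dist_degree j != 0.
  by move=> jd; rewrite gt_eqF // dist_degree_gt0.
have b0 j : (j < d)%N -> (b j)%:R != 0 :> R.
  by move=> jd; rewrite pnatr_eq0 -lt0n drg_b_gt0.
have c0 j : (j < d)%N -> (c j.+1)%:R != 0 :> R.
  by move=> jd; rewrite pnatr_eq0 -lt0n drg_c_gt0.
have [mi|ni1] := eqVneq m i.+1.
  have id' : (i < d)%N by rewrite -mi.
  rewrite /beta id' mi !gtn_eqF ?ltnS ?leq_pred // !mul0r !mulr0 !add0r /=.
  by field; rewrite K0 // b0 // c0.
have [mi|ni] := eqVneq m i.
  case: i {ni1} => [|i] in id mi *; first by rewrite mi drg_c0 /=; ring.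
  by rewrite mi gtn_eqF // mulr0n mulr1n; ring.
case: i ni ni1 id => [|i] ni ni1 id /=; first by rewrite drg_c0 mulr0n; ring.
rewrite eqSS eq_sym mulr0n; case: eqP => [->|_]; last by rewrite mulr0n; ring.
rewrite mulr1n !mul0r !mulr0 !addr0.
by field; rewrite ?K0 ?b0 ?c0 // ltnW.
Qed.

Lemma dist_mx1 x y : dist_mx 1 x y = (e (enum_val x) (enum_val y))%:R / k%:R.
Proof.
rewrite mxE gdist_eq1 //= drg_b0 mul1r.
(* For adjacent vertices, the only neighbour of one at distance 0 from the other is that other. *)
suff -> : c 1%N = 1%N by rewrite divr1.
have [u [v duv]] := gdist_attained econn esym T0 d0.
have euv : e u v by rewrite -gdist_eq1 // duv.
rewrite -duv -card_nbr_closer duv; apply: etrans (cards1 u); apply: eq_card => z.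
by rewrite !inE eqSS gdist_eq0 // eq_sym andbC; case: eqP => //= ->; rewrite esym.
Qed.

Lemma dist_mx_eigenvector (v : 'rV[R]_#|T|) t w :
  v *m adjacency R e = t *: v -> cosine_sequence d k b c t w ->
  forall i, (i <= d)%N -> v *m dist_mx i = w i *: v.
Proof.
move=> vA [w0 w1 wrec].
apply: (three_term_eigenvector (al := intersection_a) (be := beta)
  (ga := fun i => (c i)%:R) dist_mx0 _ _ _ w0 vA).
- by move=> i /dist_mx_recurrence[].
- by move=> i /ltnW/dist_mx_recurrence[].
(* The recurrence in [cosine_sequence] starts at index 1; at index 0 it amounts to w_1 = theta / k,
   since c_0 = a_0 = 0 and b_0 = k. *)
move=> [|i] id; rewrite /beta id.
  rewrite drg_c0 drg_b0 w0 w1 /intersection_a drg_c0 drg_b0.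
  by field; rewrite pnatr_eq0 -lt0n drg_k_gt0.
by apply: wrec => /=; lia.
Qed.

Lemma cosine_sequence_valency : cosine_sequence d k b c (k%:R : R) (fun=> 1).
Proof.
split=> // [|i _ a]; last by rewrite /a; ring.
by rewrite divff // pnatr_eq0 -lt0n drg_k_gt0.
Qed.

Lemma adjacency_const : (const_mx 1 : 'rV_#|T|) *m adjacency R e = k%:R *: const_mx 1.
Proof.
apply/rowP => y; rewrite !mxE mulr1 -(card_nbr (enum_val y)).
rewrite -sum1_card natr_sum [in RHS]big_mkcond /= -sum_enum_val.
by apply: eq_bigr => z _; rewrite !mxE !inE esym mul1r; case: (e _ _).
Qed.

(** The all-ones vector is an eigenvector for [k] with constant cosine sequence 1, so it is fixed by
    every [dist_mx i]. *)
Lemma dist_mx_colsum i y : (i <= d)%N -> \sum_x dist_mx i x y = 1.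
Proof.
move=> /(dist_mx_eigenvector adjacency_const cosine_sequence_valency).
move=> /rowP/(_ y); rewrite !mxE mulr1 => <-.
by apply: eq_bigr => x _; rewrite !mxE mul1r.
Qed.

End DistanceMatrices.

(** * Dot products and quadratic energies *)

Section Energy.
Variables (R : realType) (n : nat).
Implicit Types (u v : 'rV[R]_n) (B : 'M[R]_n).

Definition dot u v : R := \sum_x u 0 x * v 0 x.

Definition energy B v : R := \sum_x \sum_y B x y * (v 0 x - v 0 y) ^+ 2.

Lemma dotZl a u v : dot (a *: u) v = a * dot u v.
Proof. by rewrite mulr_sumr; apply: eq_bigr => x _; rewrite mxE mulrA. Qed.

Lemma dot_suml (I : finType) (F : I -> 'rV[R]_n) v :
  dot (\sum_i F i) v = \sum_i dot (F i) v.
Proof.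
rewrite exchange_big; apply: eq_bigr => x _ /=.
by rewrite summxE mulr_suml.
Qed.

Lemma dotC u v : dot u v = dot v u.
Proof. by apply: eq_bigr => x _; rewrite mulrC. Qed.

Lemma dot_ge0 v : 0 <= dot v v.
Proof. by apply: sumr_ge0 => x _; rewrite -expr2 sqr_ge0. Qed.

Lemma dot_gt0 v : v != 0 -> 0 < dot v v.
Proof.
move=> v0; rewrite lt_def dot_ge0 andbT; apply: contraNneq v0 => dv0.
apply/eqP/rowP => x; rewrite mxE; apply/eqP; rewrite -sqrf_eq0 expr2.
move/eqP: dv0; rewrite psumr_eq0 => [/allP/(_ x (mem_index_enum _))//|y _].
by rewrite -expr2 sqr_ge0.
Qed.

Lemma dot_sym_mulmx B u v :
  (forall x y, B x y = B y x) -> dot (u *m B) v = dot u (v *m B).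
Proof.
move=> symB; rewrite /dot.
under eq_bigr do rewrite mxE mulr_suml.
rewrite exchange_big; apply: eq_bigr => x _ /=.
rewrite mxE mulr_sumr; apply: eq_bigr => y _; rewrite (symB y x); ring.
Qed.

Lemma energyE B v : (forall x y, B x y = B y x) ->
    (forall y, \sum_x B x y = 1) ->
  energy B v = (dot v v - dot (v *m B) v) *+ 2.
Proof.
move=> symB sumB.
have sumBr x : \sum_y B x y = 1 by rewrite -(sumB x); apply: eq_bigr.
have -> : energy B v = \sum_x \sum_y B x y * (v 0 x * v 0 x)
    + \sum_x \sum_y B x y * (v 0 y * v 0 y)
    - (\sum_y \sum_x v 0 x * B x y * v 0 y) *+ 2.
  rewrite [X in _ - X *+ 2]exchange_big -sumrMnl -big_split -sumrB.
  apply: eq_bigr => x _; rewrite -sumrMnl -big_split -sumrB.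
  by apply: eq_bigr => y _ /=; ring.
rewrite [X in _ + X - _]exchange_big /=.
rewrite mulrnBl mulr2n; congr (_ + _ - _ *+ 2).
- by apply: eq_bigr => x _; rewrite -mulr_suml sumBr mul1r.
- by apply: eq_bigr => x _; rewrite -mulr_suml sumB mul1r.
- by apply: eq_bigr => y _; rewrite mxE mulr_suml.
Qed.

End Energy.

(** * Euclidean norm, expansion and contraction *)

Lemma enorm_gt0 (R : realType) n (v : 'rV[R]_n) : v != 0 -> 0 < enorm v.
Proof.
move=> /dot_gt0; rewrite /enorm sqrtr_gt0 /dot.
by under eq_bigr do rewrite -expr2.
Qed.

Lemma sqr_enorm (R : realType) n (v : 'rV[R]_n) : enorm v ^+ 2 = \sum_i v 0 i ^+ 2.
Proof. by rewrite sqr_sqrtr // sumr_ge0 // => i _; exact: sqr_ge0. Qed.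

Lemma expansion_ge0 (R : realType) (T : finType) (e : rel T) n
    (rho : T -> 'rV[R]_n) : 0 <= expansion e rho.
Proof. exact: bigmax_ge_id. Qed.

Lemma contraction_ge0 (R : realType) (T : finType) (e : rel T) n
    (rho : T -> 'rV[R]_n) : 0 <= contraction e rho.
Proof. exact: bigmax_ge_id. Qed.

(** * Poincaré inequality and the distortion bound *)

Section Poincare.
Variables (R : realType) (T : finType) (e : rel T) (k : nat) (b c : nat -> nat).
Hypothesis hG : distance_regular e k b c.
Let d := diameter e.
Hypothesis d0 : (0 < d)%N.
Let A := adjacency R e.
Let B := dist_mx R e b c.

Lemma dist_mx_energy_eigenvector t w v i : cosine_sequence d k b c t w ->
  v *m A = t *: v -> (i <= d)%N -> energy (B i) v = (1 - w i) * dot v v *+ 2.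
Proof.
move=> cos_w vA id; rewrite energyE => [|x y|y].
- by rewrite (dist_mx_eigenvector hG d0 vA cos_w id) dotZl mulrBl mul1r.
- exact: (dist_mx_sym R hG).
- exact: (dist_mx_colsum R hG d0).
Qed.

(** The entries of [B i] are nonnegative, so the energy of an eigenvector is too, and it is a
    positive multiple of [1 - w i]. *)
Lemma cosine_le1 t w i : cosine_sequence d k b c t w -> eigenvalue A t ->
  (i <= d)%N -> w i <= 1.
Proof.
move=> cos_w /eigenvalueP[v vA v0] id.
have : 0 <= energy (B i) v.
  apply: sumr_ge0 => x _; apply: sumr_ge0 => y _.
  by rewrite mulr_ge0 ?sqr_ge0 // (dist_mx_ge0 _ hG).
rewrite (dist_mx_energy_eigenvector cos_w vA id) pmulrn_lge0 //.
by rewrite pmulr_lge0 ?dot_gt0 // subr_ge0.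
Qed.

Variables (theta : 'I_d.+1 -> R) (w : 'I_d.+1 -> nat -> R).
Hypothesis theta_decr : forall i j : 'I_d.+1, (i < j)%N -> theta j < theta i.
Hypothesis theta_eig :
  forall a : R, eigenvalue A a <-> exists j, a = theta j.
Hypothesis cos_w : forall j, cosine_sequence d k b c (theta j) (w j).

Let eig_theta j : eigenvalue A (theta j).
Proof. by apply/theta_eig; exists j. Qed.

Lemma const_mx1_neq0 : (const_mx 1 : 'rV[R]_#|T|) != 0.
Proof.
have /card_gt0P[x _] := card_gt0_of_diameter d0.
by apply/negP => /eqP/rowP/(_ (enum_rank x)) /eqP; rewrite !mxE oner_eq0.
Qed.

Lemma theta_le_valency j : theta j <= k%:R.
Proof.
have := cosine_le1 (cos_w j) (eig_theta j) d0.
by have [_ -> _] := cos_w j; rewrite ler_pdivrMr ?mul1r // ltr0n (drg_k_gt0 hG).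
Qed.

(** The all-ones vector makes [k] an eigenvalue, and no eigenvalue exceeds it. *)
Lemma theta0_valency : theta ord0 = k%:R.
Proof.
have : eigenvalue A k%:R.
  apply/eigenvalueP; exists (const_mx 1); last exact: const_mx1_neq0.
  exact: adjacency_const hG.
move=> /theta_eig[j kj]; case: (posnP j) => [j0|/(theta_decr (i := ord0))].
  by rewrite kj; congr theta; apply: val_inj.
by rewrite -kj => /(le_lt_trans (theta_le_valency ord0)); rewrite ltxx.
Qed.

(** Both [w ord0] and the constant sequence 1 give the factor by which [B i] scales the all-ones
    vector. *)
Lemma cosine_theta0 i : (i <= d)%N -> w ord0 i = 1.
Proof.
move=> id; have wA := adjacency_const R hG.
have cos0 := cos_w ord0; rewrite theta0_valency in cos0.
have := dist_mx_eigenvector hG d0 wA cos0 id.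
rewrite (dist_mx_eigenvector hG d0 wA (cosine_sequence_valency R hG d0) id).
by move=> /eqP; rewrite -subr_eq0 -scalerBl scaler_eq0 (negPf const_mx1_neq0)
  orbF subr_eq0 => /eqP.
Qed.

Lemma cosine1_lt1 (j : 'I_d.+1) : (0 < j)%N -> w j 1%N < 1.
Proof.
have k0 : 0 < k%:R :> R by rewrite ltr0n (drg_k_gt0 hG).
move=> /(theta_decr (i := ord0)); rewrite theta0_valency.
by have [_ -> _] := cos_w j; rewrite ltr_pdivrMr ?mul1r.
Qed.

Lemma dist_mx_energy_le r t v : (r <= d)%N ->
    (forall j : 'I_d.+1, (0 < j)%N -> t * (1 - w j r) <= 1 - w j 1%N) ->
  t * energy (B r) v <= energy (B 1) v.
Proof.
move=> rd tw.
have [u [-> uA]] : exists u : 'I_d.+1 -> 'rV_#|T|,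
    v = \sum_j u j /\ forall j, u j *m A = theta j *: u j.
  apply: (three_term_eigen_decomposition (dist_mx0 R hG) (dist_mx_diameterS _ _ _ _)
    (dist_mx_recurrence R hG d0)) => // i j.
  by case: (ltngtP i j) => [/theta_decr|/theta_decr|/val_inj->//] lt eq;
    rewrite eq ltxx in lt.
have symA x y : A x y = A y x by rewrite !mxE; case: hG => -[-> _].
(* Moving the symmetric [A] across the dot product gives (theta_i - theta_j) <u_i, u_j> = 0. *)
have orth i j : i != j -> dot (u i) (u j) = 0.
  move=> ij; have := dot_sym_mulmx (u i) (u j) symA.
  rewrite !uA dotZl (dotC _ (_ *: _)) dotZl (dotC (u j)) => /eqP.
  rewrite -subr_eq0 -mulrBl mulf_eq0 => /orP[|/eqP->//].
  rewrite subr_eq0; case: (ltngtP i j) ij => [/theta_decr|/theta_decr|/val_inj->].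
  - by move=> /gt_eqF->.
  - by move=> /lt_eqF->.
  - by rewrite eqxx.
have E i : (i <= d)%N ->
    energy (B i) (\sum_j u j) = \sum_j (1 - w j i) * dot (u j) (u j) *+ 2.
  move=> id; rewrite energyE => [|x y|y].
  - rewrite mulmx_suml !dot_suml -sumrB -sumrMnl; apply: eq_bigr => j _.
    rewrite (dist_mx_eigenvector hG d0 (uA j) (cos_w j) id) dotZl.
    rewrite dotC dot_suml (bigD1 j) //= big1 => [|l /orth //].
    by rewrite addr0 mulrBl mul1r.
  - exact: (dist_mx_sym R hG).
  - exact: (dist_mx_colsum R hG d0).
rewrite !E // mulr_sumr ler_sum // => j _.
rewrite -mulrnAr mulrA -[leRHS]mulrnAr ler_wpM2r ?mulrn_wge0 ?dot_ge0 //.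
(* The component of index 0 contributes nothing to either energy, so bounds for positive [j]
   suffice. *)
have [j0|] := posnP j; last exact: tw.
have -> : j = ord0 by exact: val_inj.
by rewrite !cosine_theta0 // subrr mulr0.
Qed.

Lemma sum_energy n (rho : T -> 'rV[R]_n) i :
  \sum_l energy (B i) (\row_x rho (enum_val x) 0 l) =
  \sum_x \sum_y B i x y * enorm (rho (enum_val x) - rho (enum_val y)) ^+ 2.
Proof.
rewrite exchange_big; apply: eq_bigr => x _; rewrite exchange_big.
apply: eq_bigr => y _ /=; rewrite sqr_enorm mulr_sumr.
by apply: eq_bigr => l _; rewrite !mxE.
Qed.

Lemma sum_dist_mx i : (i <= d)%N -> \sum_x \sum_y B i x y = #|T|%:R.
Proof.
move=> id; rewrite exchange_big /=.
under eq_bigr => y _ do rewrite (dist_mx_colsum R hG d0 y id).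
by rewrite sumr_const card_ord.
Qed.

(** [B 1] is supported on edges, where the ratio in [expansion] is the length itself, and its
    entries sum to [#|T|]. *)
Lemma sum_energy_le_expansion n (rho : T -> 'rV[R]_n) :
  \sum_l energy (B 1) (\row_x rho (enum_val x) 0 l) <=
  expansion e rho ^+ 2 * #|T|%:R.
Proof.
rewrite sum_energy -(sum_dist_mx d0) mulr_sumr; apply: ler_sum => x _.
rewrite mulr_sumr; apply: ler_sum => y _.
rewrite [leLHS]mulrC /B (dist_mx1 R hG d0).
case: (boolP (e _ _)) => exy; last by rewrite mulr0n mul0r !mulr0.
have [[esym eirr] econn _ _ _] := hG.
rewrite ler_wpM2r ?divr_ge0 // lerXn2r ?nnegrE ?expansion_ge0 ?sqrtr_ge0 //.
have := exy; rewrite -(gdist_eq1 econn esym eirr) => /eqP dxy.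
apply: le_trans (le_bigmax_cond _ _ (j := (enum_val x, enum_val y)) _) => /=.
  by rewrite dxy divr1.
by apply: contraTneq exy => ->; rewrite eirr.
Qed.

(** [B r] is supported on pairs at distance [r], whose images are at least [r] divided by
    [contraction] apart. *)
Lemma sum_energy_ge_contraction n (rho : T -> 'rV[R]_n) r :
    injective rho -> (0 < r <= d)%N ->
  r%:R ^+ 2 * #|T|%:R <= contraction e rho ^+ 2 *
    \sum_l energy (B r) (\row_x rho (enum_val x) 0 l).
Proof.
move=> inj_rho /andP[r0 rd].
rewrite sum_energy -(sum_dist_mx rd) !mulr_sumr; apply: ler_sum => x _.
rewrite !mulr_sumr; apply: ler_sum => y _.
rewrite mulrCA [leRHS]mulrC; have := dist_mx_ge0 R hG d0 x y rd.
rewrite /B mulrC /dist_mx mxE; case: eqP => [dxy K0|_ _]; last first.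
  by rewrite mulr0n !mul0r !mulr0.
rewrite mulrC ler_wpM2r // -exprMn.
have [_ econn _ _ _] := hG.
have xy : enum_val x != enum_val y.
  by rewrite -(gdist_eq0 econn) dxy -lt0n.
have n0 : 0 < enorm (rho (enum_val x) - rho (enum_val y)).
  by rewrite enorm_gt0 // subr_eq0 (inj_eq inj_rho).
rewrite lerXn2r ?nnegrE ?mulr_ge0 ?ler0n ?contraction_ge0 ?sqrtr_ge0 //.
rewrite -ler_pdivrMr // -dxy.
exact: le_trans (le_bigmax_cond _ _ (j := (enum_val x, enum_val y)) _).
Qed.

Lemma poincare_distortion n (rho : T -> 'rV[R]_n) r t :
    injective rho -> (0 < r <= d)%N -> 0 <= t ->
    (forall j : 'I_d.+1, (0 < j)%N -> t * (1 - w j r) <= 1 - w j 1%N) ->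
  t * r%:R ^+ 2 <= distortion e rho ^+ 2.
Proof.
move=> inj_rho rd t0 tw.
have T0 : 0 < #|T|%:R :> R by rewrite ltr0n (card_gt0_of_diameter d0).
rewrite -(ler_pM2r T0) -mulrA.
apply: le_trans (ler_wpM2l t0 (sum_energy_ge_contraction inj_rho rd)) _.
rewrite mulrCA /distortion exprMn -[leRHS]mulrA [leRHS]mulrCA ler_wpM2l ?sqr_ge0 //.
apply: le_trans (sum_energy_le_expansion rho).
rewrite mulr_sumr; apply: ler_sum => l _; apply: dist_mx_energy_le tw.
by case/andP: rd.
Qed.

Lemma poincare_c2 r t : (0 < r <= d)%N -> 0 <= t ->
    (forall j : 'I_d.+1, (0 < j)%N -> t * (1 - w j r) <= 1 - w j 1%N) ->
  t * r%:R ^+ 2 <= c2 R e ^+ 2.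
Proof.
move=> rd t0 tw.
(* Square roots give a lower bound for the distortions themselves, which passes to the infimum. *)
suff : Num.sqrt t * r%:R <= c2 R e.
  move=> le; rewrite -[t in leLHS]sqr_sqrtr // -exprMn.
  by rewrite lerXn2r ?nnegrE ?(le_trans _ le) ?mulr_ge0 ?sqrtr_ge0.
apply: lb_le_inf => [|D [n [rho [inj_rho ->]]]].
  (* The standard basis embedding shows that the set of distortions is nonempty. *)
  pose rho x : 'rV[R]_#|T| := delta_mx 0 (enum_rank x).
  exists (distortion e rho), #|T|, rho; split=> // x y /rowP/(_ (enum_rank x)).
  rewrite !mxE !eqxx /= (inj_eq enum_rank_inj); case: eqP => // _ /eqP.
  by rewrite oner_eq0.
have D0 : 0 <= distortion e rho.
  by rewrite mulr_ge0 ?expansion_ge0 ?contraction_ge0.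
rewrite -(ler_sqr _ D0) ?nnegrE ?mulr_ge0 ?sqrtr_ge0 //.
by rewrite exprMn sqr_sqrtr //; apply: poincare_distortion tw.
Qed.

End Poincare.

(** * The bound in the extended reals *)

(* Division on \bar R satisfies x / 0 = +oo for x > 0. *)
Theorem theorem1p4 (R : realType) (T : finType) (e : rel T) (d k : nat)
    (b c : nat -> nat) (theta : 'I_d.+1 -> R) (w : 'I_d.+1 -> nat -> R)
    (hG : distance_regular e k b c)
    (hdiam : diameter e = d)
    (hd : (2 <= d)%N)
    (htheta_decr : forall i j : 'I_d.+1, (i < j)%N -> theta j < theta i)
    (htheta : forall a : R,
       eigenvalue (adjacency R e) a <-> exists j, a = theta j)
    (hw : forall j, cosine_sequence d k b c (theta j) (w j)) :
  (\big[maxe/-oo]_(r <- [:: d.-1; d])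
      ((r%:R ^+ 2)%:E *
       \big[mine/+oo]_(j < d.+1 | (0 < j)%N)
          ((1 - w j 1%N)%:E / (1 - w j r)%:E))
   <= (c2 R e ^+ 2)%:E)%E.
Proof.
subst d; set d := diameter e in theta w htheta_decr hw hd htheta *.
have d0 : (0 < d)%N by exact: ltnW.
rewrite big_seq_cond; apply: bigmax_le => [|r]; first exact: leNye.
rewrite andbT => rin.
have {rin} rd : (0 < r <= d)%N.
  (* Here [2 <= d] makes [d.-1] positive. *)
  by move: rin; rewrite !inE => /orP[]/eqP->; rewrite -/d; lia.
have P t := @poincare_c2 R T e k b c hG d0 theta w htheta_decr htheta hw r t rd.
have r2 : 0 < r%:R ^+ 2 :> R by rewrite exprn_gt0 // ltr0n; case/andP: rd.
have w1 := cosine1_lt1 hG d0 htheta_decr htheta hw.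
have wr (j : 'I_d.+1) : w j r <= 1.
  apply: (cosine_le1 hG d0 (hw j)); last by case/andP: rd.
  by apply/htheta; exists j.
set m := \big[_/_]_(_ < _ | _) _.
(* Each real [t] below the minimum is admissible in [poincare_c2]: an infinite quotient means
   [w j r = 1], where the constraint is just [w j 1 <= 1]. *)
have m_le (t : R) : (t%:E <= m)%E ->
    forall j : 'I_d.+1, (0 < j)%N -> t * (1 - w j r) <= 1 - w j 1%N.
  move=> tm j j0.
  have := le_trans tm (bigmin_le_cond _ _ j0).
  have [->|wr1] := eqVneq (w j r) 1.
    by rewrite subrr mulr0 subr_ge0 (ltW (w1 _ j0)).
  have lt1 : 0 < 1 - w j r by rewrite subr_gt0 lt_neqAle wr1 wr.
  by rewrite inver gt_eqF // -EFinM lee_fin ler_pdivlMr.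
have c2_ge0 : 0 <= c2 R e ^+ 2 by exact: sqr_ge0.
case: m m_le => [t||_].
- move=> /(_ t (lexx _)) tw; rewrite -EFinM lee_fin mulrC.
  (* A negative minimum gives a bound below the nonnegative square. *)
  have [t0|/ltW t0] := leP 0 t; first exact: P.
  by apply: le_trans c2_ge0; rewrite mulr_le0_ge0 // ltW.
  (* Every w j r would be 1, so poincare_c2 would hold for arbitrarily large t. *)
- move=> /(_ ((c2 R e ^+ 2 + 1) / r%:R ^+ 2) (leey _)) tw.
  have t0 : 0 <= (c2 R e ^+ 2 + 1) / r%:R ^+ 2 by rewrite divr_ge0 ?addr_ge0 // ltW.
  have := P _ t0 tw; rewrite divfK ?gt_eqF // => le1.
  by rewrite gerDl ler10 in le1.
- by rewrite gt0_muleNy ?lte_fin // leNye.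
Qed.
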